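(* For every positive integer $n$ and all real numbers $x,\alpha$ with $(x,\alpha)\neq(0,0)$, the Dickson polynomial of the first kind $D_n(x,\alpha)$ satisfies $$D_n(x,\alpha)=\frac{x^{\delta(n)}\,\Omega_0\big(\lfloor n/2\rfloor\,|\,\alpha,\,2\alpha-x^2\,|\,n\big)}{(n-1)(n-2)\cdots(n-\lfloor n/2\rfloor)}.$$
   Context: For an integer $m\ge 0$, $\delta(m)\in\{0,1\}$ is the residue of $m$ modulo $2$, and $t^0=1$ for every $t$. The Dickson polynomial of the first kind is $$D_n(x,\alpha)=\sum_{i=0}^{\lfloor n/2\rfloor}\frac{n}{n-i}\binom{n-i}{i}(-\alpha)^i x^{n-2i}\qquad(n\ge 1).$$ For a positive integer $n$ and a point $(\zeta,\xi)\ne(0,0)$, the Omega sequence $\Omega_r(k|\zeta,\xi|n)$, for integers $r,k\ge 0$ with $r+k\le\lfloor n/2\rfloor$, is defined by $\Omega_r(0|\zeta,\xi|n)=1$ for all $r$ and, for $k\ge 1$, $$\Omega_r(k|\zeta,\xi|n)=(2\zeta-\xi)(n-r-k)\,\Omega_r(k-1|\zeta,\xi|n)-2\zeta\,(n-2r-\delta(n-1))\,\Omega_{r+1}(k-1|\zeta,\xi|n).$$ The product $(n-1)(n-2)\cdots(n-\lfloor n/2\rfloor)$ is $\prod_{j=1}^{\lfloor n/2\rfloor}(n-j)$; an empty product equals $1$. *)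

(* Defs.v *)
From mathcomp Require Import all_boot all_order all_algebra.

Set Implicit Arguments.
Unset Strict Implicit.
Unset Printing Implicit Defensive.

Import GRing.Theory.
Local Open Scope ring_scope.

Definition delta (m : nat) : nat := (m %% 2)%N.

(* Dickson polynomial of the first kind, meant for n >= 1: there i <= n/2 < n,
   so the denominator n - i never vanishes. *)
Definition dickson (R : numFieldType) (n : nat) (x alpha : R) : R :=
  \sum_(0 <= i < (n %/ 2).+1)
     n%:R / (n%:R - i%:R) * 'C(n - i, i)%:R * (- alpha) ^+ i
       * x ^+ (n - 2 * i).

(* Omega_r(k | zeta, xi | n).  The index r changes in the recursive call, so it
   comes after the recursion argument k.  The sequence is meant for n >= 1 and
   r + k <= n/2; this range is stable under the recursion, and values outside
   of it are irrelevant.  The subtractions of coefficients take place in R,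
   except n - 1, which is not truncated for n >= 1. *)
Fixpoint Omega (R : numFieldType) (zeta xi : R) (n k r : nat) : R :=
  if k is k'.+1 then
    (2 * zeta - xi) * (n%:R - r%:R - k%:R) * Omega zeta xi n k' r
    - 2 * zeta * (n%:R - 2 * r%:R - (delta (n - 1))%:R)
        * Omega zeta xi n k' r.+1
  else 1.

(* Main.v *)
Require Import Defs.
From mathcomp Require Import all_boot all_order all_algebra.
From mathcomp Require Import reals.
From mathcomp Require Import ring zify.

(** The recursion for Omega can be solved in closed form.  One step either keeps
    [r], lowers [r + k] by one and contributes [(2 zeta - xi)(n - r - k)], or
    raises [r], keeps [r + k] and contributes
    [-2 zeta (n - 2 r - delta (n - 1))].  The numerical factor of the first kind
    of step depends only on [r + k], which only that kind changes, and that of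
    the second kind only on [r], which only that kind changes.  So the total
    weight of a sequence of [k] steps depends only on the number [i] of steps
    of the second kind, and not on their order: summing over sequences gives
    the binomial expansion [OmegaE].

    For [zeta = alpha] and [xi = 2 alpha - x ^ 2] one has
    [2 zeta - xi = x ^ 2], so with [r = 0] and [k] the half [m] of [n] the
    [i]-th term is a multiple of [alpha ^ i x ^ (2 (m - i))], as in the Dickson
    polynomial.  The product of the [m - i] factors of the first kind is the
    tail of the denominator [(n - 1) ... (n - m)] and cancels, leaving
    [(n - 1) ... (n - i)].  In the other factors the numbers [2 (m - j)] and
    [n - 2 j - delta (n - 1)], for [j < i], are the even and the odd ones among
    [n, n - 1, ..., n - 2 i + 1]; hence [2 ^ i 'C(m, i)] times the product of
    the latter is the falling factorial [n ^_ (2 i)] over [i!]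
    ([ffact_parity_split]), and the coefficient becomes
    [n / (n - i) 'C(n - i, i)] ([dickson_coefE]). *)

Import GRing.Theory.
Import Num.Theory.
Local Open Scope ring_scope.

Lemma sum_binS (R : pzRingType) (k : nat) (F : nat -> R) :
  \sum_(i < k.+2) 'C(k.+1, i)%:R * F i =
  \sum_(i < k.+1) 'C(k, i)%:R * (F i + F i.+1).
Proof.
rewrite big_ord_recl /= bin0.
under eq_bigr => i _ do rewrite /bump /= add1n binS natrD mulrDl.
under [RHS]eq_bigr => i _ do rewrite mulrDr.
rewrite !big_split /= addrA; congr (_ + _).
rewrite big_ord_recr /= bin_small // mul0r addr0 [RHS]big_ord_recl /= bin0.
by congr (_ + _); apply: eq_bigr.
Qed.

(** The two products collect the numerical factors of the [i] steps that raise
    [r] and of the [k - i] steps that keep it; the binomial coefficient counts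
    their orders. *)
Lemma OmegaE (R : numFieldType) (zeta xi : R) (n k r : nat) :
  Omega zeta xi n k r =
  \sum_(i < k.+1) 'C(k, i)%:R *
    ((- (2 * zeta)) ^+ i * (2 * zeta - xi) ^+ (k - i)
     * \prod_(j < i) (n%:R - 2 * (r%:R + j%:R) - (delta (n - 1))%:R)
     * \prod_(j < k - i) (n%:R - r%:R - k%:R + j%:R)).
Proof.
elim: k r => [|k IHk] r /=.
  by rewrite big_ord1 bin0 !big_ord0 !expr0 !mulr1.
rewrite !IHk.
rewrite (sum_binS R k (fun i => (- (2 * zeta)) ^+ i
  * (2 * zeta - xi) ^+ (k.+1 - i)
  * \prod_(j < i) (n%:R - 2 * (r%:R + j%:R) - (delta (n - 1))%:R)
  * \prod_(j < k.+1 - i) (n%:R - r%:R - k.+1%:R + j%:R))).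
rewrite !mulr_sumr -sumrB; apply: eq_bigr => -[i /= ik] _.
rewrite subSS subSn; last by [].
rewrite !big_ord_recl /= !exprS !addr0.
under [X in _ = _ * (_ * (_ * X) + _)]eq_bigr => j _ do
  (rewrite /bump /= add1n (_ : _ + j.+1%:R = n%:R - r%:R - k%:R + j%:R);
    last by rewrite -!natr1; ring).
under [X in _ = _ * (_ + _ * (_ * X) * _)]eq_bigr => j _ do
  (rewrite /bump /= add1n (_ : _ - _ = n%:R - 2 * (r.+1%:R + j%:R)
    - (delta (n - 1))%:R); last by rewrite -!natr1; ring).
under [X in _ = _ * (_ + _ * X)]eq_bigr => j _ do
  (rewrite (_ : _ + j%:R = n%:R - r.+1%:R - k%:R + j%:R);
    last by rewrite -!natr1; ring).
rewrite -!natr1; ring.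
Qed.

Lemma natr_ffact (R : pzRingType) (n i : nat) :
  (n ^_ i)%:R = \prod_(j < i) (n%:R - j%:R) :> R.
Proof.
elim: i => [|i IHi]; first by rewrite big_ord0 ffactn0.
rewrite big_ord_recr /= -IHi ffactnSr natrM.
have [le_in | lt_ni] := leqP i n; first by rewrite natrB.
by rewrite ffact_small // !mul0r.
Qed.

Lemma ffactnD (n i j : nat) : (n ^_ (i + j) = n ^_ i * (n - i) ^_ j)%N.
Proof.
elim: j => [|j IHj]; first by rewrite addn0 ffactn0 muln1.
by rewrite addnS !ffactnSr IHj subnDA mulnA.
Qed.

(** Half of the factors of [n ^_ (2 i)] are even: they are the doubles of the
    factors of [(n %/ 2) ^_ i]. *)
Lemma ffact_parity_split (R : comPzRingType) (n i : nat) : (0 < n)%N ->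
  2 ^+ i * ((n %/ 2) ^_ i)%:R
    * \prod_(j < i) (n%:R - 2 * j%:R - (delta (n - 1))%:R)
  = (n ^_ i.*2)%:R :> R.
Proof.
move=> n_gt0; rewrite !natr_ffact.
elim: i => [|i IHi]; first by rewrite !big_ord0 !mulr1.
rewrite doubleS !big_ord_recr /= -IHi exprS.
have En : 2 * (n %/ 2)%:R = n%:R - (delta n)%:R :> R.
  by rewrite [in n%:R](divn_eq n 2) natrD addrK natrM mulrC.
have -> : i.*2.+1%:R = 2 * i%:R + 1 :> R by rewrite -natr1 -mul2n natrM.
have -> : i.*2%:R = 2 * i%:R :> R by rewrite -mul2n natrM.
have H : 2 * ((n %/ 2)%:R - i%:R) * (n%:R - 2 * i%:R - (delta (n - 1))%:R)
    = (n%:R - 2 * i%:R) * (n%:R - (2 * i%:R + 1)) :> R.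
  rewrite [2 * (_ - _)]mulrBr En.
  have [[-> ->]|[-> ->]] : (delta n = 0 /\ delta (n - 1) = 1)%N \/
      (delta n = 1 /\ delta (n - 1) = 0)%N by rewrite /delta; lia.
  - ring.
  - ring.
rewrite -[RHS]mulrA -H; ring.
Qed.

(** Both sides times [i!] are [n ^_ (2 i) = n ^_ i * (n - i) ^_ i]; the quotient
    [n / (n - i)] turns [(n - 1) ... (n - i)] into [n ^_ i]. *)
Lemma dickson_coefE (R : numFieldType) (n i : nat) : (0 < n)%N ->
    (i <= n %/ 2)%N ->
  n%:R / (n%:R - i%:R) * 'C(n - i, i)%:R * \prod_(j < i) (n%:R - j.+1%:R)
  = 2 ^+ i * 'C(n %/ 2, i)%:R
    * \prod_(j < i) (n%:R - 2 * j%:R - (delta (n - 1))%:R) :> R.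
Proof.
move=> n_gt0 le_im.
have lt_in : (i < n)%N by lia.
have ni_neq0 : n%:R - i%:R != 0 :> R by rewrite -natrB ?pnatr_eq0; lia.
have fact_neq0 : i`!%:R != 0 :> R by rewrite pnatr_eq0 -lt0n fact_gt0.
have shiftE : n%:R * \prod_(j < i) (n%:R - j.+1%:R)
    = (n ^_ i)%:R * (n%:R - i%:R) :> R.
  rewrite natr_ffact -[RHS](@big_ord_recr _ _ _ _ (fun j => n%:R - j%:R)).
  by rewrite big_ord_recl subr0.
apply: (mulIf fact_neq0).
have -> : 2 ^+ i * 'C(n %/ 2, i)%:R
    * \prod_(j < i) (n%:R - 2 * j%:R - (delta (n - 1))%:R) * i`!%:R
    = (n ^_ i.*2)%:R :> R.
  by rewrite -ffact_parity_split // -bin_ffact natrM; ring.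
have -> : (n ^_ i.*2 = n ^_ i * (n - i) ^_ i)%N.
  by rewrite -addnn ffactnD.
rewrite natrM -[((n - i) ^_ i)%N]bin_ffact natrM.
transitivity (n%:R * \prod_(j < i) (n%:R - j.+1%:R) / (n%:R - i%:R)
  * ('C(n - i, i)%:R * i`!%:R) : R); first by ring.
by rewrite shiftE mulfK.
Qed.

Lemma prod_tail (R : comPzRingType) (a : R) (m i : nat) : (i <= m)%N ->
  \prod_(1 <= j < m.+1) (a - j%:R) =
  \prod_(j < i) (a - j.+1%:R) * \prod_(j < m - i) (a - m%:R + j%:R).
Proof.
move=> le_im; rewrite big_add1 /= (big_cat_nat (leq0n i) le_im) /= big_mkord.
congr (_ * _).
(* The right-hand product runs upwards from a - m, the other one downwards. *)
rewrite big_nat_rev /= -{1}[i]add0n big_addn big_mkord.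
apply: eq_bigr => -[j /= jm] _.
rewrite -addrA; congr (_ + _).
have -> : ((i + m - (j + i).+1).+1 = m - j)%N by lia.
by rewrite natrB; [ring | lia].
Qed.

Theorem theorem51 (R : realType) (n : nat) (n_gt0 : (0 < n)%N) (x alpha : R)
    (xalpha_neq0 : (x, alpha) <> (0, 0)) :
  dickson n x alpha =
  x ^+ delta n * Omega alpha (2 * alpha - x ^+ 2) n (n %/ 2) 0
    / \prod_(1 <= j < (n %/ 2).+1) (n%:R - j%:R).
Proof.
have D_neq0 : \prod_(1 <= j < (n %/ 2).+1) (n%:R - j%:R) != 0 :> R.
  rewrite prodf_seq_neq0; apply/allP => j; rewrite mem_index_iota => j_lt /=.
  by rewrite -natrB ?pnatr_eq0; lia.
apply: (mulIf D_neq0); rewrite mulfVK // OmegaE subKr /dickson big_mkord.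
rewrite mulr_suml mulr_sumr; apply: eq_bigr => -[i /= i_lt] _.
have le_im : (i <= n %/ 2)%N by [].
rewrite (prod_tail R n%:R (n %/ 2) i le_im) subr0.
have -> : (n - 2 * i = delta n + 2 * (n %/ 2 - i))%N by rewrite /delta; lia.
rewrite exprD exprM -mulrN [(2 * - alpha) ^+ i]exprMn.
under [X in _ = _ * (_ * (_ * X * _))]eq_bigr => j _ do rewrite add0r.
have coefE := dickson_coefE R n i n_gt0 le_im.
transitivity (n%:R / (n%:R - i%:R) * 'C(n - i, i)%:R
  * \prod_(j < i) (n%:R - j.+1%:R)
  * ((- alpha) ^+ i * x ^+ delta n * (x ^+ 2) ^+ (n %/ 2 - i)
     * \prod_(j < n %/ 2 - i) (n%:R - (n %/ 2)%:R + j%:R)) : R).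
  by ring.
by rewrite coefE; ring.
Qed.
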